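(* Let $\tau=\{\tau_1,\dots,\tau_n\}$ be an asynchronous periodic constrained-deadline task system with $\tau_i=(O_i,C_i,D_i,T_i)$, and let $\mathcal{S}$ be the schedule of $\tau$ constructed by the global-EDF scheduler upon $m$ identical CPUs. Assume that $\mathcal{S}$ is valid (no deadline is ever missed). Let $O_{\max}=\max\{O_1,\dots,O_n\}$, $P=\operatorname{lcm}\{T_1,\dots,T_n\}$, $C_\tau=\sum_{i=1}^n C_i$ and $$t_{\mathrm{up}}=O_{\max}+(C_\tau+1)\cdot P .$$ Then there exists a time instant $t>0$ with $t-P\ge O_{\max}$ and $t\le t_{\mathrm{up}}$ such that $C_{\mathcal{S}}(\tau,t-P)=C_{\mathcal{S}}(\tau,t)$.
   Context: **Task model.** All timing quantities are non-negative integers and time is discrete. A periodic constrained-deadline task $\tau_i=(O_i,C_i,D_i,T_i)$ has first release time (offset) $O_i\ge 0$, worst-case execution time $C_i$, relative deadline $D_i\le T_i$, and period $T_i\geq 1$. It generates infinitely many jobs $\tau_{i,j}$, $j\ge 1$; job $\tau_{i,j}$ is released at $O_{i,j}=O_i+(j-1)T_i$ and must complete within $[O_{i,j},d_{i,j})$, where $d_{i,j}=O_{i,j}+D_i$ is its absolute deadline. Every job of $\tau_i$ is assumed to have execution requirement exactly $C_i$. The system is synchronous if all $O_i$ are equal, and asynchronous otherwise. A job is active at time $t$ if it has been released at or before $t$ and is not yet completed. Tasks are independent; no job can execute on more than one CPU at the same time. All CPUs have the same computing capacity. Preemptions and migrations are allowed at no cost. **Scheduler.** Global-EDF is the preemptive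 global scheduler in which each job has a fixed priority, a job with a shorter absolute deadline having higher priority; ties are broken by a fixed rule, giving a total priority order on jobs. At each time instant the (at most $m$) highest-priority active jobs are executed. The implementation is assumed to be: - deterministic: it generates a unique schedule for any given set of jobs; - work-conserving: it never idles a CPU while there is an active job that is not running; - request-dependent: if $\tau_{i,k}$ has higher priority than $\tau_{j,\ell}$, then $\tau_{i,k+P/T_i}$ has higher priority than $\tau_{j,\ell+P/T_j}$, where $P=\operatorname{lcm}\{T_1,\dots,T_n\}$. **Configuration.** For a schedule $\mathcal{S}$ of $\tau$ and $t\ge O_{\max}$, the configuration $C_{\mathcal{S}}(\tau,t)$ is the $n$-tuple $(e_{1,t},\dots,e_{n,t})$, where $e_{i,t}$ is the amount of time for which task $\tau_i$ has executed since its last release time up until time $t$; $0\le e_{i,t}\le C_i$. ($e_{i,t}$ is undefined if $t<O_i$, and the configuration is undefined if some $e_{i,t}$ is.) *)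

(* Defs.v *)
From mathcomp Require Import all_boot.

Set Implicit Arguments.
Unset Strict Implicit.
Unset Printing Implicit Defensive.

Record task := Task {
  offset : nat;
  wcet : nat;
  rel_deadline : nat;
  period : nat
}.

(* Job indices start at 0: the pair (i, j) is the (j+1)-st job of task i. *)
Definition job (n : nat) : Type := ('I_n * nat)%type.

Section TaskSystem.

Variables (n : nat) (tau : 'I_n -> task).

Definition periodic := forall i, 1 <= period (tau i).
Definition constrained_deadline :=
  forall i, rel_deadline (tau i) <= period (tau i).

Definition synchronous := forall i j, offset (tau i) = offset (tau j).
Definition asynchronous := ~ synchronous.

Definition release (J : job n) := offset (tau J.1) + J.2 * period (tau J.1).
Definition deadline (J : job n) := release J + rel_deadline (tau J.1).

Definition O_max := \max_(i < n) offset (tau i).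
Definition hyperperiod := \big[lcmn/1]_(i < n) period (tau i).
Definition C_total := \sum_(i < n) wcet (tau i).
Definition t_up := O_max + (C_total + 1) * hyperperiod.

End TaskSystem.

(* S t k is the job executed on CPU k during the time slot [t, t+1), or None
   when the CPU is idle. *)
Definition schedule (n m : nat) := nat -> 'I_m -> option (job n).

(* A scheduler maps a set of jobs to a schedule. *)
Definition scheduler (n m : nat) := pred (job n) -> schedule n m.

Section Schedule.

Variables (n m : nat) (tau : 'I_n -> task) (S : schedule n m).

Definition runs (J : job n) (t : nat) : bool := [exists k, S t k == Some J].

Definition service (J : job n) (t : nat) : nat := \sum_(0 <= s < t) runs J s.

Definition completed (J : job n) (t : nat) : bool :=
  wcet (tau J.1) <= service J t.

Definition active (A : pred (job n)) (J : job n) (t : nat) : bool :=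
  [&& A J, release tau J <= t & ~~ completed J t].

Definition valid : Prop := forall J : job n, completed J (deadline tau J).

Definition task_runs (i : 'I_n) (t : nat) : bool :=
  [exists k, omap fst (S t k) == Some i].

(* Meaningful only for offset (tau i) <= t. *)
Definition last_release (i : 'I_n) (t : nat) : nat :=
  offset (tau i)
    + (t - offset (tau i)) %/ period (tau i) * period (tau i).

Definition exec_since_release (i : 'I_n) (t : nat) : nat :=
  \sum_(last_release i t <= s < t) task_runs i s.

(* None encodes an undefined configuration. *)
Definition configuration (t : nat) : option (n.-tuple nat) :=
  if [forall i, offset (tau i) <= t]
  then Some [tuple exec_since_release i t | i < n]
  else None.

End Schedule.

Section GlobalEDF.

Variables (n m : nat) (tau : 'I_n -> task).

(* prio J J' reads: J has (strictly) higher priority than J'. *)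
Variable prio : rel (job n).

Definition strict_total_order : Prop :=
  [/\ irreflexive prio, transitive prio
    & forall J J', J != J' -> prio J J' || prio J' J].

Definition earliest_deadline_first : Prop :=
  forall J J', deadline tau J < deadline tau J' -> prio J J'.

Definition next_hyperperiod (J : job n) : job n :=
  (J.1, J.2 + hyperperiod tau %/ period (tau J.1)).

Definition request_dependent : Prop :=
  forall J J', prio J J' -> prio (next_hyperperiod J) (next_hyperperiod J').

Variable sched : scheduler n m.

(* Being a function, sched yields one schedule per predicate; this says that
   it depends only on the set of jobs that the predicate denotes. *)
Definition deterministic : Prop :=
  forall A B : pred (job n), A =1 B -> sched A =2 sched B.

Definition runs_active_only : Prop :=
  forall A J t, runs (sched A) J t -> active tau (sched A) A J t.

Definition no_parallelism : Prop :=
  forall A J t k k',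
    sched A t k = Some J -> sched A t k' = Some J -> k = k'.

Definition work_conserving : Prop :=
  forall A J t, active tau (sched A) A J t -> ~~ runs (sched A) J t ->
    forall k, sched A t k != None.

Definition respects_priority : Prop :=
  forall A J J' t, active tau (sched A) A J t -> ~~ runs (sched A) J t ->
    runs (sched A) J' t -> prio J' J.

(* The last four fields together say that the jobs running at t are
   exactly the min(m, number of active jobs) highest-priority active ones. *)
Record global_EDF : Prop := GlobalEDF {
  gedf_order : strict_total_order;
  gedf_deadline : earliest_deadline_first;
  gedf_request_dependent : request_dependent;
  gedf_deterministic : deterministic;
  gedf_active : runs_active_only;
  gedf_no_parallelism : no_parallelism;
  gedf_work_conserving : work_conserving;
  gedf_priority : respects_priority
}.

End GlobalEDF.

(* Main.v *)
Require Import Defs.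
From mathcomp Require Import all_boot.

(** Write [J + P] for the job released one hyperperiod [P] after [J].  By
    induction on [t], [J + P] has received at time [t + P] at most the service
    that [J] has received at time [t].  In the only critical slot both services
    are equal and [J + P] runs while [J] waits; then all [m] CPUs serve jobs
    [J'] of higher priority than [J], the jobs [J' + P] are still active by
    induction, and they have higher priority than [J + P], so they occupy all
    CPUs at [t + P].  Hence configurations are componentwise nonincreasing along
    [O_max + k P], and a nonincreasing sequence of naturals starting at most at
    [C_total] must be stationary at one of its first [C_total + 1] steps. *)

Lemma nonincreasing_stationary (f : nat -> nat) (N : nat) :
  (forall k, f k.+1 <= f k) -> f 0 <= N -> exists2 k, k <= N & f k.+1 = f k.
Proof.
elim: N f => [|N IHN] f f_anti f0.
  exists 0 => //; apply/eqP; rewrite eqn_leq f_anti.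
  by move: f0; rewrite leqn0 => /eqP ->.
(* Either the first step is stationary, or the strict drop bounds the shifted sequence by [N]. *)
have [f10|f10] := eqVneq (f 1) (f 0); first by exists 0.
have [||k kN fk] := IHN (f \o succn); last by exists k.+1.
  by move=> k; apply: f_anti.
by rewrite /= -ltnS (leq_trans _ f0) // ltn_neqAle f10 f_anti.
Qed.

Section Hyperperiod.

Variables (n : nat) (tau : 'I_n -> task).

Local Notation P := (hyperperiod tau).

Lemma dvdn_period_hyperperiod (i : 'I_n) : period (tau i) %| P.
Proof. by rewrite /hyperperiod (bigD1 i) //= dvdn_lcml. Qed.

Lemma hyperperiod_gt0 : periodic tau -> 0 < P.
Proof.
move=> tau_periodic; rewrite /hyperperiod.
by elim/big_ind: _ => // x y x0 y0; rewrite lcmn_gt0 x0.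
Qed.

Lemma release_next_hyperperiod (J : job n) :
  release tau (next_hyperperiod tau J) = release tau J + P.
Proof.
by rewrite /release /= mulnDl addnA divnK // dvdn_period_hyperperiod.
Qed.

Lemma next_hyperperiod_inj : injective (next_hyperperiod tau).
Proof. by move=> [i j] [i' j'] [<-] /addIn ->. Qed.

Definition last_job (i : 'I_n) (t : nat) : job n :=
  (i, (t - offset (tau i)) %/ period (tau i)).

Lemma last_jobDhyperperiod (i : 'I_n) (t : nat) : offset (tau i) <= t ->
  last_job i (t + P) = next_hyperperiod tau (last_job i t).
Proof.
move=> it; rewrite /last_job /next_hyperperiod /= -addnBAC //.
by rewrite divnDr // dvdn_period_hyperperiod.
Qed.

(** The quotient defining [last_job] is at least [j] because [(i, j)] is released before [t], and at
    most [j] because the last release before [t] precedes the release of [(i, j.+1)]. *)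
Lemma last_job_unique (i : 'I_n) (j s t : nat) : periodic tau ->
    last_release tau i t <= s < t ->
    release tau (i, j) <= s -> s < release tau (i, j.+1) ->
  (i, j) = last_job i t.
Proof.
move=> tau_periodic; rewrite /last_release /release /= => /andP[ts st] rs sr.
have T0 := tau_periodic i; congr (_, _); apply/eqP.
have Ot : offset (tau i) <= t.
  by apply: leq_trans (ltnW st); apply: leq_trans rs; apply: leq_addr.
rewrite eqn_leq leq_divRL // leq_subRL // (leq_trans rs (ltnW st)) /=.
by move: (leq_ltn_trans ts sr); rewrite ltn_add2l ltn_mul2r T0 ltnS.
Qed.

End Hyperperiod.

Section ActiveOnly.

Variables (n m : nat) (tau : 'I_n -> task) (S : schedule n m).
Variable A : pred (job n).
Hypothesis S_active : forall J t, runs S J t -> active tau S A J t.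

Lemma serviceS (J : job n) (t : nat) :
  service S J t.+1 = service S J t + runs S J t.
Proof. by rewrite /service big_nat_recr. Qed.

Lemma leq_service (J : job n) (s t : nat) :
  s <= t -> service S J s <= service S J t.
Proof.
by move=> st; rewrite /service [leqRHS](@big_cat_nat _ _ _ s) //= leq_addr.
Qed.

Lemma service_le_wcet (J : job n) (t : nat) :
  service S J t <= wcet (tau J.1).
Proof.
elim: t => [|t IHt]; first by rewrite /service big_geq.
rewrite serviceS; case Jt: (runs S J t); last by rewrite addn0.
by have /and3P[_ _] := S_active _ _ Jt; rewrite -ltnNge addn1.
Qed.

Lemma task_runsP (i : 'I_n) (t : nat) :
  reflect (exists j, runs S (i, j) t) (task_runs S i t).
Proof.
apply: (iffP existsP) => [[k]|[j /existsP[k /eqP Sk]]]; last first.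
  by exists k; rewrite Sk.
case Sk: (S t k) => [[i' j]|] //= /eqP[<-].
by exists j; apply/existsP; exists k; rewrite Sk.
Qed.

(** Reduces a configuration entry, which counts slots of a whole task, to the service of a single
    job, which can be compared across a hyperperiod. *)
Lemma exec_since_releaseE (i : 'I_n) (t : nat) :
    periodic tau -> constrained_deadline tau -> valid tau S ->
    offset (tau i) <= t ->
  exec_since_release tau S i t = service S (last_job n tau i t) t.
Proof.
move=> tau_periodic tau_constrained S_valid it.
have rt : last_release tau i t <= t.
  by rewrite /last_release -leq_subRL // leq_trunc_div.
rewrite /service (@big_cat_nat _ _ _ (last_release tau i t)) //=.
rewrite [X in _ = X + _]big_nat_cond [X in _ = X + _]big1 => [|s].
  rewrite add0n; apply: eq_big_nat => s ts; congr nat_of_bool.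
  apply/task_runsP/idP => [[j ij]|]; last by eexists; eassumption.
  have /and3P[_ rs ncomp] := S_active _ _ ij.
  rewrite -(last_job_unique n tau i j s t) //.
  (* Since deadlines are at most periods, a job whose successor is released by [s] has met its
     deadline by then, so it cannot run at [s]. *)
  rewrite ltnNge; apply: contra ncomp => sr; apply: leq_trans (S_valid _) _.
  apply: leq_service; apply: leq_trans sr.
  by rewrite /deadline /release /= mulSn -addnA leq_add2l addnC leq_add2r.
rewrite andbT => /= sr; apply/eqP; rewrite eqb0.
apply/negP => /S_active /and3P[_ rs _].
by move: sr; rewrite ltnNge => /negP[]; apply: rs.
Qed.

End ActiveOnly.

Section GlobalEDF.

Variables (n m : nat) (tau : 'I_n -> task) (prio : rel (job n)).
Variable sched : scheduler n m.
Hypothesis sched_gEDF : global_EDF tau prio sched.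

Local Notation P := (hyperperiod tau).
Local Notation S := (sched xpredT).

Lemma service_next_hyperperiod (J : job n) (t : nat) :
  service S (next_hyperperiod tau J) (t + P) <= service S J t.
Proof.
have [[prio_irr prio_trans _] _ prio_next _ S_active S_par S_wc S_prio] :=
  sched_gEDF.
have {}S_active := S_active xpredT.
(* Having received no more service than [K], the shifted job is incomplete whenever [K] is. *)
have stepP : forall K u, active tau S xpredT K u ->
    service S (next_hyperperiod tau K) (u + P) <= service S K u ->
    active tau S xpredT (next_hyperperiod tau K) (u + P).
  move=> K u /and3P[_ ru ncomp] serv; rewrite /active /=.
  rewrite release_next_hyperperiod leq_add2r ru /=.
  by apply: contra ncomp => comp; apply: leq_trans comp serv.
elim: t J => [|t IHt] J.
  (* [J + P] is released no earlier than [P]. *)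
  rewrite add0n /service big_nat_cond big1 // => s; rewrite andbT => sP.
  apply/eqP; rewrite eqb0; apply/negP => /S_active /and3P[_].
  rewrite release_next_hyperperiod leqNgt => /negP[].
  by rewrite (leq_trans sP) // leq_addl.
rewrite addSn !serviceS.
have [Jt|nJt] := boolP (runs S J t); first by rewrite leq_add // leq_b1.
have [nextJt|_] := boolP (runs S _ _); last by rewrite !addn0.
rewrite addn0 addn1 ltn_neqAle IHt andbT; apply/eqP => eq_serv.
have actJ : active tau S xpredT J t.
  have /and3P[_] := S_active _ _ nextJt.
  rewrite release_next_hyperperiod leq_add2r /active /= => ->.
  by rewrite /completed eq_serv.
(* The default [J] is never taken: [J] waits at [t], so work conservation keeps every CPU busy. *)
pose cpu_job k := odflt J (S t k).
have S_next k : S t k = Some (cpu_job k).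
  by have := S_wc _ _ _ actJ nJt k; rewrite /cpu_job; case: (S t k).
have runs_job k : runs S (cpu_job k) t.
  by apply/existsP; exists k; rewrite -S_next.
(* Otherwise [J + P] would have priority over the waiting [cpu_job k + P], against request
   dependence. *)
have runs_next k : runs S (next_hyperperiod tau (cpu_job k)) (t + P).
  have [//|nrun] := boolP (runs S _ _).
  have actk := stepP _ _ (S_active _ _ (runs_job k)) (IHt _).
  have up := S_prio _ _ _ _ actk nrun nextJt.
  have down := prio_next _ _ (S_prio _ _ _ _ actJ nJt (runs_job k)).
  by have := prio_trans _ _ _ up down; rewrite prio_irr.
have /fin_all_exists[cpu cpuP] : forall k, exists l,
    S (t + P) l = Some (next_hyperperiod tau (cpu_job k)).
  by move=> k; have /existsP[l /eqP] := runs_next k; exists l.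
have cpu_inj : injective cpu.
  move=> k k' eq_cpu; apply: (S_par xpredT (cpu_job k) t) => //.
  rewrite S_next; congr Some; apply: (next_hyperperiod_inj n tau).
  by apply: Some_inj; rewrite -!cpuP eq_cpu.
have /existsP[l /eqP Sl] := nextJt.
(* An injection of the finite set of CPUs into itself is onto, so the CPU running [J + P] at [t + P]
   runs some [cpu_job k + P]; then [J] is [cpu_job k], which runs at [t]. *)
have [cpu' _ cpuK] := injF_bij cpu_inj.
have /Some_inj/next_hyperperiod_inj eqJ :
    Some (next_hyperperiod tau J) =
    Some (next_hyperperiod tau (cpu_job (cpu' l))).
  by rewrite -cpuP cpuK.
by move: nJt; rewrite eqJ runs_job.
Qed.

End GlobalEDF.

Theorem lemma5 (n m : nat) (tau : 'I_n -> task) (prio : rel (job n))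
    (sched : scheduler n m) (S : schedule n m)
    (tau_periodic : periodic tau)
    (tau_constrained : constrained_deadline tau)
    (tau_async : asynchronous tau)
    (sched_gEDF : global_EDF tau prio sched)
    (S_def : S = sched xpredT)
    (S_valid : valid tau S) :
  exists t : nat,
    [/\ 0 < t,
        O_max tau + hyperperiod tau <= t,
        t <= t_up tau
      & configuration tau S (t - hyperperiod tau) = configuration tau S t].
Proof.
have S_active : forall J t, runs S J t -> active tau S xpredT J t.
  by rewrite S_def; apply: gedf_active sched_gEDF xpredT.
set P := hyperperiod tau.
have offset_le i k : offset (tau i) <= O_max tau + k * P.
  by rewrite (leq_trans _ (leq_addr _ _)) // /O_max (bigD1 i) //= leq_maxl.
have execE i t := exec_since_releaseE n m tau S xpredT S_active i t
  tau_periodic tau_constrained S_valid.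
pose e k i := exec_since_release tau S i (O_max tau + k * P).
have e_anti k i : e k.+1 i <= e k i.
  rewrite /e !execE // mulSn addnCA addnC last_jobDhyperperiod //.
  by rewrite S_def; apply: service_next_hyperperiod sched_gEDF _ _.
(* Summing over the tasks yields one [k] at which all entries are stationary simultaneously. *)
have [|| k kC sum_eq] :=
    nonincreasing_stationary (fun k => \sum_i e k i) (C_total tau).
- by move=> k; apply: leq_sum.
- apply: leq_sum => i _; rewrite /e execE //.
  exact: service_le_wcet S_active _ _.
(* Termwise inequalities whose sums agree are all equalities. *)
have e_eq i : e k.+1 i = e k i.
  have /leqif_sum[_] : forall i, true ->
      e k.+1 i <= e k i ?= iff (e k.+1 i == e k i).
    by move=> j _; split.
  by rewrite sum_eq eqxx => /esym/forallP/(_ i)/eqP.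
exists (O_max tau + k.+1 * P); split.
- by rewrite ltn_addl // muln_gt0 hyperperiod_gt0.
- by rewrite leq_add2l leq_pmull.
- by rewrite /t_up leq_add2l leq_mul2r addn1 ltnS kC orbT.
have -> : O_max tau + k.+1 * P - P = O_max tau + k * P.
  by rewrite mulSn addnCA addKn.
rewrite /configuration !ifT; try by apply/forallP.
by congr Some; apply/eq_from_tnth => i; rewrite !tnth_mktuple -/(e k i) -e_eq.
Qed.
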